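(* Let $k \geq 1$ and let $a_1 \geq a_2 \geq \dots \geq a_k > 0$ be integers. Then the number of ways to play Stanley Solitaire starting from the position $[a_1, \dots, a_k]$ until all the candies are eaten equals $$ \frac{(a_1+ \dots + a_k)!}{(a_1+k-1)!\,(a_2+k-2)! \cdots (a_k)!} \cdot \prod_{1 \leq i < j \leq k} (a_i-a_j+j-i), $$ where the denominator is $\prod_{i=1}^{k} (a_i+k-i)!$.
   Context: Stanley Solitaire is a one-player game played on a one-dimensional board whose squares are numbered $1,2,3,\dots$ (the left end is fixed, the board is unbounded to the right). A position assigns to each square $i$ a number $a_i \in \mathbb{Z}_{\geq 0}$ of candies, with only finitely many $a_i$ nonzero. The notation $[a_1,\dots,a_k]$ means the position with $a_i$ candies on square $i$ for $1 \leq i \leq k$ and no candies on squares $i>k$. The empty position (all $a_i = 0$) is denoted $[\,]$. Legal move: choose an index $i \geq 1$ with $a_i > a_{i+1}$ (the right pile, on square $i+1$, may be empty), exchange the two piles, and eat one candy of the larger pile (the one that was initially on the left and is now on the right). That is, the pair $(a_i, a_{i+1})$ is replaced by $(a_{i+1}, a_i - 1)$ and all other squares are unchanged. In particular, if the rightmost nonempty pile is on square $k$, then moving from $[a_1,\dots,a_k]$ to $[a_1,\dots,a_{k-1},0,a_k-1]$ is always legal. Each move removes exactly one candy. When writing positions one may delete zeros at the left and right ends; this does not affect which moves are available on the remaining piles. The number of ways to play from a given starting position is the number of sequences of legal moves (a move being specified by the chosen index $i$) that lead from the starting position to the empty position $[\,]$, i.e. the number of ways to legally eat all the candies. For example, the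 number of ways is $2$ from $[2,1]$ and $5$ from $[2,2,1]$. *)

(* Defs.v *)
From mathcomp Require Import all_boot.

Set Implicit Arguments.
Unset Strict Implicit.
Unset Printing Implicit Defensive.

(* Squares are indexed from 0: [nth 0 p i] is the number of candies on square  *)
(* i + 1 of the board.  All squares beyond [size p] are empty, so trailing     *)
(* zeros are irrelevant; [a_1, ..., a_k] is the sequence of the a_i itself.    *)
Definition position := seq nat.

Definition candies (p : position) (i : nat) : nat := nth 0 p i.

Definition is_empty (p : position) : bool := all (pred1 0) p.

Definition legal (p : position) (i : nat) : bool :=
  candies p i.+1 < candies p i.

(* [set_nth] extends the sequence when square i.+1 lies beyond its end. *)
Definition make_move (p : position) (i : nat) : position :=
  set_nth 0 (set_nth 0 p i (candies p i.+1)) i.+1 (candies p i).-1.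

(* [is_way p w]: the moves listed in w are successively legal from p, and the  *)
(* last one leads to the empty position.                                       *)
Fixpoint is_way (p : position) (w : seq nat) : bool :=
  if w is i :: w' then legal p i && is_way (make_move p i) w' else is_empty p.

(* Main.v *)
Require Import Defs.
From mathcomp Require Import all_boot all_order all_algebra all_fingroup.
From mathcomp Require Import boolp classical_sets functions cardinality.
From mathcomp Require Import finmap zify ring.

Set Implicit Arguments.
Unset Strict Implicit.
Unset Printing Implicit Defensive.

Import GRing.Theory.

(** Read the position as the inversion code of a permutation u, code u i being
the number of later letters smaller than u i.  A legal move at i is exactly the
exchange of two adjacent letters u i > u (i + 1): the codes are exchanged and
the larger one drops by 1.  So the ways to play are the ways to sort u by
adjacent exchanges (its reduced words), and one has to show that the number N
of these, for a code that is a partition lam, satisfies the recursion of the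
number of standard tableaux: N(lam) is the sum of N(lam - e_i) over the corners
i of lam.

Playing gives N(lam) as a sum over the same indices i, but with the position
obtained by moving at i instead of lam - e_i.  The two terms agree one by one
([dominant_move]).  This comes from the transition equation ([transition]): for
a letter r of v, the sum of N(v') over the v' covering v in the Bruhat order by
an exchange of r with a later letter equals the sum over those where r is
exchanged with an earlier one.  For the right v, each side has a single term.

The transition equation has a short algebraic proof.  Let nabla send v to the
sum of the words v s_i over its descents i, and let M_r send v to the signed
sum of the covers of v that exchange r (later letters +, earlier ones -).
Then nabla and M_r commute: [commute_step] shows it up to the terms that give
back v, and these cancel when r has a neighbour on both sides.  As N(v) is the coefficient
of the identity in a power of nabla and M_r never produces the identity, N
vanishes on M_r v.  To keep neighbours available during the induction, the
position is padded with empty squares on both sides, which changes no play.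

Finally, with b_i = lam_i + k - i, the recursion is solved by |lam|! times the
determinant of the falling factorials b_i ^_ j divided by the product of the
b_i! ([ffdet_lower]); that determinant equals the Vandermonde determinant of
the b_i ([ffdet_prod]). *)

(** * Sorting words by adjacent exchanges *)

Section Words.
Variable n : nat.
Implicit Types (u : {perm 'I_n}) (i j k m p q : 'I_n) (l : nat).

Definition code u i : nat := \sum_(m : 'I_n) ((i < m) && (u m < u i)).

Definition swap i j u : {perm 'I_n} := (tperm i j * u)%g.

Definition adj i j : bool := j == i.+1 :> nat.

(** The length l is a parameter, so that both sides of the transition equation
are defined by the same recursion; [cnt l u] vanishes unless l is the number of
inversions of u. *)
Fixpoint cnt l u : nat :=
  if l is l'.+1 then
    \sum_i \sum_(j | adj i j && (u j < u i)) cnt l' (swap i j u)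
  else [forall m : 'I_n, code u m == 0].

(** Exchanging the letters at p and q gives a cover of u in the Bruhat order. *)
Definition cov u p q : bool :=
  [&& p < q, u p < u q &
      [forall m : 'I_n, ~~ [&& p < m, m < q, u p < u m & u m < u q]]].

Lemma swapE i j u m : swap i j u m = u (tperm i j m).
Proof. by rewrite /swap permM. Qed.

Lemma swapK i j : involutive (swap i j).
Proof. by move=> u; apply/permP=> m; rewrite !swapE tpermK. Qed.

Lemma swapC i j u : swap i j u = swap j i u.
Proof. by rewrite /swap tpermC. Qed.

Lemma swap_conj i j p q u :
  swap i j (swap p q u) = swap (tperm i j p) (tperm i j q) (swap i j u).
Proof.
rewrite /swap !mulgA; congr (_ * u)%g.
by rewrite -tpermJ /conjg tpermV -!mulgA tperm2 mulg1.
Qed.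

Lemma covP u p q :
  reflect [/\ p < q, u p < u q &
     forall m : 'I_n, p < m -> m < q -> u p < u m -> u m < u q -> False] (cov u p q).
Proof.
apply: (iffP and3P) => [[pq upq /forallP none]|[pq upq none]]; split=> //.
  by move=> m a b c d; move: (none m); rewrite a b c d.
by apply/forallP=> m; apply/and4P=> -[]; apply: none.
Qed.

Lemma perm_val_inj u i j : u i = u j :> nat -> i = j :> nat.
Proof. by move=> /val_inj/perm_inj->. Qed.

Lemma tperm_val i j m :
  tperm i j m = (if m == i :> nat then j else if m == j :> nat then i else m)
    :> nat.
Proof.
by rewrite !val_eqE; case: tpermP => [->|->|/eqP/negPf-> /eqP/negPf->];
  rewrite ?eqxx //; case: eqP => [->|].
Qed.

Lemma tperm_lt i j p q : adj i j -> ~~ ((p == i) && (q == j)) -> p < q ->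
  tperm i j p < tperm i j q.
Proof.
rewrite /adj -!val_eqE /= => /eqP ij npq pq; rewrite !tperm_val.
by repeat case: ifP => ?; lia.
Qed.

(** The heart of the commutation.  Away from the case {i, j} = {p, q}, an
exchange of adjacent positions keeps the relative order of p and q and of all
positions between them, except that a letter may enter or leave the interval
between p and q when i or j is one of its ends.  The descent condition compares
that letter with one of u p, u q on the left of the equation and with the other
one on the right; the side where the letter is inside the interval also asks
that it does not lie between u p and u q, which makes both sides agree. *)
Lemma cov_swap i j p q u : adj i j ->
    ~~ ((p == i) && (q == j)) -> ~~ ((p == j) && (q == i)) ->
  (cov u p q && (swap p q u j < swap p q u i)) =
  ((u j < u i) && cov (swap i j u) (tperm i j p) (tperm i j q)).
Proof.
move=> ij n1 n2; have /eqP ijn := ij.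
apply/andP/andP=> [[/covP[pq upq none] desc]|[desc /covP[]]].
- have uji: u j < u i.
    move: desc; rewrite !swapE.
    case: tpermP => [?|?|/eqP jp /eqP jq]; case: tpermP => [?|?|/eqP ip /eqP iq];
      subst; rewrite ?eqxx //= in n1 n2 *; try lia.
    + have := none i; have := @perm_val_inj u i q; move: ip iq; rewrite -!val_eqE /=; lia.
    + have := none j; have := @perm_val_inj u j p; move: jp jq; rewrite -!val_eqE /=; lia.
  split=> //; apply/covP; split; rewrite ?swapE ?tpermK //; first exact: tperm_lt.
  move=> m; rewrite -{1 2}(tpermK i j m) swapE; move: (tperm i j m) => {}m.
  move=> pm mq um1 um2; case: (ltngtP m p) => mp.
  + case: (boolP ((m == i) && (p == j))) => [/andP[/eqP mi /eqP pj]|nn].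
      subst; move: desc; rewrite !swapE tpermL tpermD -?val_eqE /=; lia.
    by have := tperm_lt ij nn mp; lia.
  + case: (ltngtP q m) => mq'.
    * case: (boolP ((q == i) && (m == j))) => [/andP[/eqP qi /eqP mj]|nn].
        subst; move: desc; rewrite !swapE tpermR tpermD -?val_eqE /=; lia.
      by have := tperm_lt ij nn mq'; lia.
    * exact: (none m).
    * by move/val_inj: mq' mq => ->; lia.
  + by move/val_inj: mp pm => ->; lia.
- rewrite !swapE !tpermK => pq upq none'.
  have {}pq: p < q.
    rewrite -(tpermK i j p) -(tpermK i j q); apply: tperm_lt => //.
    by rewrite !(can2_eq (tpermK i j) (tpermK i j)) tpermL tpermR.
  have none (m : 'I_n) : tperm i j p < tperm i j m -> tperm i j m < tperm i j q ->
      u p < u m -> u m < u q -> False.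
    by move=> pm mq um1 um2; apply: (none' (tperm i j m));
      rewrite ?swapE ?tpermK.
  split.
    apply/covP; split=> // m pm mq um1 um2; apply: (none m) => //.
      apply: tperm_lt => //; apply/negP=> /andP[/eqP ? /eqP ?]; subst; lia.
    apply: tperm_lt => //; apply/negP=> /andP[/eqP ? /eqP ?]; subst; lia.
  case: (tpermP p q j) => [?|?|/eqP jp /eqP jq];
  case: (tpermP p q i) => [?|?|/eqP ip /eqP iq];
      subst; rewrite ?eqxx //= in n1 n2 *; try lia.
  + have := none i; rewrite tpermL tpermR tpermD; try first
      [done | by rewrite eq_sym | by rewrite -val_eqE /=; lia].
    have := @perm_val_inj u i q; move: ip iq; rewrite -!val_eqE /=; lia.
  + have := none j; rewrite tpermL tpermR tpermD; try first
      [done | by rewrite eq_sym | by rewrite -val_eqE /=; lia].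
    have := @perm_val_inj u j p; move: jp jq; rewrite -!val_eqE /=; lia.
Qed.
End Words.

(** * The transition equation *)

Section Words.
Variable n : nat.
Implicit Types (u : {perm 'I_n}) (i j k m p q : 'I_n) (l : nat).

(** The argument is the same for the covers to the right of p and those to its
left; C stands for [cov u p q] or [cov u q p]. *)
Section Commute.
Variable C : {perm 'I_n} -> 'I_n -> 'I_n -> bool.
Hypothesis C_swap : forall i j p q u, adj i j ->
    ~~ ((p == i) && (q == j)) -> ~~ ((p == j) && (q == i)) ->
  (C u p q && (swap p q u j < swap p q u i)) =
  ((u j < u i) && C (swap i j u) (tperm i j p) (tperm i j q)).

Let same i j p q := ((p == i) && (q == j)) || ((p == j) && (q == i)).

(** One step of sorting after a cover against a cover after one step of
sorting.  The position p of the followed letter is carried along by the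
exchange, hence [tperm i j p].  The additional sums collect the pairs where the
exchange undoes, or is undone by, the cover: they return the word u itself. *)
Lemma commute_step l u p :
  let A q i j := adj i j && (C u p q && (swap p q u j < swap p q u i)) in
  let B q i j :=
    adj i j && ((u j < u i) && C (swap i j u) (tperm i j p) (tperm i j q)) in
  \sum_(q | C u p q) cnt l.+1 (swap p q u)
    + \sum_q \sum_i \sum_j (same i j p q && B q i j) * cnt l u
  = \sum_i \sum_(j | adj i j && (u j < u i))
      \sum_(q | C (swap i j u) (tperm i j p) q)
        cnt l (swap (tperm i j p) q (swap i j u))
    + \sum_q \sum_i \sum_j (same i j p q && A q i j) * cnt l u.
Proof.
move=> A B.
have -> : \sum_(q | C u p q) cnt l.+1 (swap p q u) =
    \sum_q \sum_i \sum_j A q i j * cnt l (swap i j (swap p q u)).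
  rewrite big_mkcond; apply: eq_bigr => q _ /=; rewrite /A.
  case: (C u p q) => /=.
    apply: eq_bigr => i _; rewrite big_mkcond; apply: eq_bigr => j _.
    by case: (_ && _); rewrite ?mul1n.
  by rewrite big1 // => i _; rewrite big1 // => j _; rewrite andbF.
have -> : \sum_i \sum_(j | adj i j && (u j < u i))
      \sum_(q | C (swap i j u) (tperm i j p) q)
        cnt l (swap (tperm i j p) q (swap i j u)) =
    \sum_q \sum_i \sum_j B q i j * cnt l (swap i j (swap p q u)).
  rewrite [RHS]exchange_big; apply: eq_bigr => i _.
  rewrite [RHS]exchange_big big_mkcond; apply: eq_bigr => j _ /=.
  under [RHS]eq_bigr do rewrite /B andbA.
  case: (adj i j && _) => /=; last by rewrite big1.
  rewrite (reindex_inj (@perm_inj _ (tperm i j))) big_mkcond.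
  by apply: eq_bigr => q _; rewrite -swap_conj; case: (C _ _ _); rewrite ?mul1n.
rewrite -!big_split; apply: eq_bigr => q _; rewrite -!big_split.
apply: eq_bigr => i _; rewrite -!big_split; apply: eq_bigr => j _ /=.
rewrite /A /B; case: (boolP (adj i j)) => [ij|_]; last by rewrite !andbF.
case: (boolP (same i j p q)) ; last first.
  by case/norP=> n1 n2; rewrite C_swap // !addn0.
by case/orP=> /andP[/eqP<- /eqP<-]; rewrite ?[swap q p _]swapC swapK addnC.
Qed.
End Commute.

Lemma cov_adj u p q : adj p q -> cov u p q = (u p < u q).
Proof.
move/eqP=> pq; apply/covP/idP=> [[] //|upq]; split=> // [|m]; lia.
Qed.

Lemma sum_point (P : 'I_n -> 'I_n -> 'I_n -> bool) q0 i0 j0 (b : bool) c :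
  (forall q i j, P q i j = [&& q == q0, i == i0, j == j0 & b]) ->
  \sum_q \sum_i \sum_j P q i j * c = b * c.
Proof.
move=> PE; rewrite (bigD1 q0) //= (bigD1 i0) //= (bigD1 j0) //= PE !eqxx.
rewrite !big1 ?addn0 // => [q ne|i ne|j ne]; last by rewrite PE (negPf ne) !andbF.
  by rewrite big1 // => i _; rewrite big1 // => j _; rewrite PE (negPf ne).
by rewrite big1 // => j _; rewrite PE (negPf ne) andbF.
Qed.

(** The word u itself occurs on the two sides of the two instances of
[commute_step] with total coefficients 1 and 1: the letter at p is either
smaller or larger than its right neighbour, and likewise for the left one.  Both
neighbours exist at each of the l steps because p is at distance at least l
from both ends. *)
Lemma transition l u p : l <= p -> p + l < n ->
  \sum_(q | cov u p q) cnt l (swap p q u) =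
  \sum_(q | cov u q p) cnt l (swap p q u).
Proof.
elim: l u p => [|l IH] u p lp pl.
  have nz p' q' (v : {perm 'I_n}) : p' < q' -> v q' < v p' -> cnt 0 v = 0.
    move=> pq vqp /=; apply/eqP; rewrite eqb0; apply/forallP=> /(_ p').
    by rewrite /code (bigD1 q') //= pq vqp.
  rewrite !big1 // => q /covP[pq upq _].
    by apply: (nz q p) => //; rewrite !swapE tpermL tpermR.
  by apply: (nz p q) => //; rewrite !swapE tpermL tpermR.
have ltpp : p.+1 < n by lia.
have ltpm : p.-1 < n by lia.
pose pp := Ordinal ltpp; pose pm := Ordinal ltpm.
have p_pp : adj p pp by rewrite /adj.
have pm_p : adj pm p by rewrite /adj /=; lia.
have covE := @commute_step (fun v p q => cov v p q) (@cov_swap n) l u p.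
have flip_swap i j p' q' v : adj i j ->
    ~~ ((p' == i) && (q' == j)) -> ~~ ((p' == j) && (q' == i)) ->
  (cov v q' p' && (swap p' q' v j < swap p' q' v i)) =
  ((v j < v i) && cov (swap i j v) (tperm i j q') (tperm i j p')).
  move=> ij n1 n2; rewrite [swap p' q' v]swapC cov_swap //.
    by rewrite andbC.
  by rewrite andbC.
have flipE := @commute_step (fun v p q => cov v q p) flip_swap l u p.
have adj_pp q : adj p q -> q = pp by move/eqP=> e; apply/val_inj.
have adj_pm q : adj q p -> q = pm by move/eqP=> e; apply/val_inj => /=; lia.
have inj1 := @perm_val_inj n u p pp; have inj2 := @perm_val_inj n u pm p.
cbv beta zeta in covE, flipE.
rewrite (@sum_point _ pm pm p (u p < u pm)) in covE; last first.
  move=> q i j; apply/idP/idP=> [/andP[Hs /and3P[ij d c]]|].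
    case/orP: Hs => /andP[/eqP ? /eqP ?]; subst; move/covP: c => [].
      by rewrite tpermL tpermR; move/eqP: ij; lia.
    by have ? := adj_pm _ ij; subst; rewrite !eqxx.
  case/and4P=> /eqP-> /eqP-> /eqP-> upp.
  by rewrite !eqxx pm_p tpermL tpermR cov_adj // !swapE tpermL tpermR upp orbT.
rewrite (@sum_point _ pp p pp (u p < u pp)) in covE; last first.
  move=> q i j; apply/idP/idP=> [/andP[Hs /and3P[ij c _]]|].
    case/orP: Hs => /andP[/eqP ? /eqP ?]; subst; last first.
      by move/covP: c => [? _ _]; move/eqP: ij; lia.
    by have ? := adj_pp _ ij; subst; rewrite !eqxx; case/covP: c.
  case/and4P=> /eqP-> /eqP-> /eqP-> upp.
  by rewrite !eqxx p_pp cov_adj // !swapE tpermL tpermR upp.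
rewrite (@sum_point _ pp p pp (u pp < u p)) in flipE; last first.
  move=> q i j; apply/idP/idP=> [/andP[Hs /and3P[ij d c]]|].
    case/orP: Hs => /andP[/eqP ? /eqP ?]; subst; move/covP: c => []; last first.
      by rewrite tpermL tpermR; move/eqP: ij; lia.
    by have ? := adj_pp _ ij; subst; rewrite !eqxx.
  case/and4P=> /eqP-> /eqP-> /eqP-> upp.
  by rewrite !eqxx p_pp tpermL tpermR cov_adj // !swapE tpermL tpermR upp.
rewrite (@sum_point _ pm pm p (u pm < u p)) in flipE; last first.
  move=> q i j; apply/idP/idP=> [/andP[Hs /and3P[ij c _]]|].
    case/orP: Hs => /andP[/eqP ? /eqP ?]; subst.
      by move/covP: c => [? _ _]; move/eqP: ij; lia.
    by have ? := adj_pm _ ij; subst; rewrite !eqxx; case/covP: c.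
  case/and4P=> /eqP-> /eqP-> /eqP-> upp.
  by rewrite !eqxx pm_p cov_adj // !swapE tpermL tpermR upp orbT.
set S1 := (X in _ = X + _) in covE; set S2 := (X in _ = X + _) in flipE.
have S12 : S1 = S2.
  apply: eq_bigr => i _; apply: eq_bigr => j /andP[/eqP ij _].
  by apply: IH; rewrite tperm_val; repeat case: ifP => ?; lia.
have lt1 : (u p < u pp) + (u pp < u p) = 1 by move: inj1 => /=; lia.
have lt2 : (u p < u pm) + (u pm < u p) = 1 by move: inj2 => /=; lia.
move: covE flipE; rewrite -S12.
move: (u p < u pp) (u pp < u p) (u p < u pm) (u pm < u p) lt1 lt2.
by do 4 case; move=> //= _ _; lia.
Qed.
End Words.

(** * Inversion codes *)

Section Words.
Variable n : nat.
Implicit Types (u : {perm 'I_n}) (i j k m p q : 'I_n) (l : nat).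

Lemma code_swap_left u i k m : m < i -> m < k -> code (swap i k u) m = code u m.
Proof.
move=> mi mk; rewrite /code (reindex_inj (@perm_inj _ (tperm i k))).
apply: eq_bigr => m' _; rewrite !swapE tpermK [tperm i k m]tpermD;
  try by rewrite -val_eqE /=; lia.
by congr (nat_of_bool (_ && _)); rewrite tperm_val; repeat case: ifP => ?; lia.
Qed.

(** A letter to the left of i has the same letters after it as before.  For one
to the right of i, the exchange matters only if it lies between the two letters
in value, which is excluded; only the inversion of i and k is new. *)
Lemma code_swap_cov u i k : i < k -> u i < u k ->
    (forall m, i < m -> u i < u m -> u m < u k -> False) ->
  forall m, code (swap i k u) m = code u m + (m == i).
Proof.
move=> ik uik none m; case: (ltngtP m i) => [mi|im|/val_inj->].
- by rewrite code_swap_left //; last exact: ltn_trans ik; rewrite -val_eqE /=; lia.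
- rewrite -val_eqE /= gtn_eqF // addn0; apply: eq_bigr => m' _; congr nat_of_bool.
  case mm: (m < m') => //=; rewrite !swapE.
  rewrite [tperm i k m']permE /= -!val_eqE /= [m' == i :> nat]gtn_eqF ?(ltn_trans im) //.
  rewrite [tperm i k m]permE /= -!val_eqE /= [m == i :> nat]gtn_eqF //.
  have := none m; have := none m'.
  have := @perm_val_inj n u m i; have := @perm_val_inj n u m' i.
  have := @perm_val_inj n u m k; have := @perm_val_inj n u m' k.
  case: (eqVneq (m' : nat) k) => [/val_inj mk|mk];
    case: (eqVneq (m : nat) k) => [/val_inj mk'|mk']; subst; lia.
- rewrite eqxx /code (bigD1 k) //= [in RHS](bigD1 k) //= !swapE tpermL tpermR ik uik.
  rewrite ltnNge ltnW //= add0n add1n addn1; congr _.+1.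
  apply: eq_bigr => m' mk; congr nat_of_bool; case im: (i < m') => //=.
  rewrite swapE tpermD ?(eq_sym k) // -?val_eqE /=; last by lia.
  have := none m'; have := @perm_val_inj n u m' i; lia.
Qed.

Lemma code_adj u i j : adj i j -> u j < u i ->
  forall m, code (swap i j u) m =
    if m == i then code u j else if m == j then (code u i).-1 else code u m.
Proof.
move=> ij uji m; have /eqP ijn := ij; case: eqP => [->|/eqP mi].
  apply: eq_bigr => m' _; congr nat_of_bool.
  rewrite !swapE tpermL; case: tpermP => [->|->|_ /eqP]; rewrite -?val_eqE /=; lia.
case: eqP => [->|/eqP mj].
  rewrite /code [in RHS](bigD1 j) //= uji ijn ltnSn /=.
  rewrite (bigD1 j) //= -{1}ijn ltnn add0n.
  apply: eq_bigr => m' m'j; congr nat_of_bool.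
  rewrite !swapE tpermR; move: m'j.
  by case: tpermP => [->|->|_ _]; rewrite -?val_eqE /=; lia.
rewrite -!val_eqE /= in mi mj.
case: (ltnP m i) => mi'; first by rewrite code_swap_left //; lia.
apply: eq_bigr => m' _; congr nat_of_bool; rewrite !swapE [tperm i j m]tpermD;
  try by rewrite -val_eqE /=; lia.
case: tpermP => [->|->|//]; lia.
Qed.

Lemma code_adj_desc u i j : adj i j -> (code u j < code u i) = (u j < u i).
Proof.
move=> ij; have /eqP ijn := ij; case uji: (u j < u i).
  rewrite /code [X in _ < X](bigD1 j) //= uji ijn ltnSn /= add1n ltnS.
  rewrite (bigD1 j) //= ltnn andbF add0n; apply: leq_sum => m mj; lia.
apply/negbTE; rewrite -leqNgt; apply: leq_sum => m _.
have := @perm_val_inj n u i j.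
by case: (altP (m =P j)) => [->|]; rewrite -?val_eqE /=; lia.
Qed.

Lemma sum_ltn_ord i : \sum_(m : 'I_n) (i < m) = n - i.+1.
Proof.
rewrite -(big_mkord xpredT (fun x => (i < x) : nat)) (big_cat_nat (n := i.+1)) //=.
rewrite big_nat_cond big1 => [|x]; last by case: ltnP => //; lia.
rewrite add0n big_nat_cond (eq_bigr (fun=> 1)) => [|x]; last by case: ltnP; lia.
by rewrite -big_nat_cond sum_nat_const_nat muln1.
Qed.

Lemma code_bound u i : i + code u i < n.
Proof.
suff: code u i <= n - i.+1 by have := ltn_ord i; lia.
by rewrite -sum_ltn_ord; apply: leq_sum => m _; lia.
Qed.

(** Codes are reached by adding inversions one at a time: exchanging u i with
the smallest larger letter to its right adds 1 to the code at i only. *)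
Lemma code_surj (a : 'I_n -> nat) : (forall i, i + a i < n) ->
  exists u, forall i, code u i = a i.
Proof.
move: {2}(\sum_i a i) (erefl (\sum_i a i)) => s.
elim: s a => [|s IH] a sa ba.
  exists 1%g => i; have/eqP := sa; rewrite sum_nat_eq0 => /forallP/(_ i)/eqP->.
  by apply: big1 => m _; rewrite !permE; lia.
have [i ai] : exists i, 0 < a i.
  apply: contrapT => none; move: sa; rewrite big1 // => i _.
  by apply/eqP; rewrite -leqn0 leqNgt; apply/negP=> ai; apply: none; exists i.
have [|m|u cu] := IH (fun m => a m - (m == i)).
- move: sa; rewrite (bigD1 i) //= => sa; rewrite (bigD1 i) //= eqxx.
  by rewrite (eq_bigr a) => [|m /negPf->]; lia.
- by have := ba m; lia.
have [k0] : exists k, (i < k) && (u i < u k).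
  apply: contrapT => none.
  suff: n - i.+1 <= code u i by have := ba i; rewrite cu eqxx; lia.
  rewrite -sum_ltn_ord; apply: leq_sum => m _.
  have all_le : (i < m) && (u i < u m) -> False by move=> h; apply: none; exists m.
  have := @perm_val_inj n u m i; lia.
move=> k0P.
have [k /andP[ik uik] kmin] :=
  @arg_minnP _ k0 (fun k => (i < k) && (u i < u k)) (fun k => u k) k0P.
exists (swap i k u) => m; rewrite code_swap_cov // => [|m' im' uim' um'k]; last first.
  by have := kmin m'; rewrite im' uim' => /(_ isT); lia.
rewrite cu; case: eqP => [->|]; lia.
Qed.

Lemma code0_min u i m : code u i = 0 -> i < m -> u i < u m.
Proof.
move/eqP; rewrite sum_nat_eq0 => /forallP/(_ m)/= + im; rewrite im /=.
have := @perm_val_inj n u m i; lia.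
Qed.

(** Codes that decrease weakly beyond d belong to words avoiding the pattern
132 there.  In an occurrence u i < u k < u j with i < j < k, let m be the last
position before j whose letter is below u k.  The letter at m + 1 is above u k,
so it exceeds all letters that u m exceeds, and u k as well: the code increases
from m to m + 1. *)
Lemma noninc_avoids d u :
    (forall i j, d <= i -> i <= j -> code u j <= code u i) ->
  forall i j k, d <= i -> i < j -> j < k -> u i < u k -> u k < u j -> False.
Proof.
move=> dec i j k di ij jk uik ukj.
pose P m := (d <= m < j) && (u m < u k).
have Pi : P i by rewrite /P di ij.
case: (arg_maxnP (fun m : 'I_n => m : nat) Pi) => m /andP[/andP[dm mj] umk] mmax.
have lt : m.+1 < n by have := ltn_ord j; lia.
have [m1 m1E] : exists m1 : 'I_n, m1 = m.+1 :> nat by exists (Ordinal lt).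
have um1 : u k < u m1.
  case: (ltngtP (u m1) (u k)) => // [lt'|/val_inj/perm_inj km1].
    have [m1j|m1j] := ltnP m1 j.
      by have /= := mmax m1; rewrite /P; lia.
    have e : m1 = j by apply/val_inj => /=; lia.
    by move: lt' ukj; rewrite e; lia.
  by move: jk mj; rewrite -km1 m1E; lia.
have um1' : u m < u m1 by lia.
have m1k : m1 < k by lia.
have := dec m m1 dm; rewrite m1E => /(_ (leqnSn _)); rewrite leqNgt => /negP; apply.
rewrite /code [X in _ < X](bigD1 k) //= [X in X < _](bigD1 k) //=.
rewrite m1k um1 /= [u k < u m]ltnNge (ltnW umk) andbF ltnS; apply: leq_sum => x _.
by have [/val_inj->|] := eqVneq (x : nat) m1; rewrite /=; lia.
Qed.
End Words.

(** * Playing on a partition *)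

Section Words.
Variable n : nat.
Implicit Types (u : {perm 'I_n}) (i j k m p q : 'I_n) (l : nat).

(** Let k > i be the position of the largest letter below u i to the right of i,
and let u' exchange u i and u k; the code of u' is that of u lowered by 1 at i.
If k = j this is the move itself.  Otherwise put the letters u j, u k, u i at
positions i, j, k to get v.  By the avoidance of 132, the only covers of v that
move the letter at j are the exchange with k, which is the move at i, and the
exchange with i, which is u'; the transition equation identifies their counts. *)
Lemma dominant_move l d u i j :
    (forall m, m < d -> code u m = 0) ->
    (forall m m', d <= m -> m <= m' -> code u m' <= code u m) ->
    d <= i -> adj i j -> u j < u i -> l <= j -> j + l < n ->
  exists2 u', cnt l (swap i j u) = cnt l u' &
    forall m, code u m = code u' m + (m == i).
Proof.
move=> pad /noninc_avoids avoid di ij uji lj jl; have /eqP ijn := ij.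
have jP : (i < j) && (u j < u i) by rewrite uji andbT; lia.
have [k /andP[ik uki] kmax] :=
  @arg_maxnP _ j (fun k => (i < k) && (u k < u i)) (fun k => u k) jP.
have {}kmax m : i < m -> u m < u i -> u m <= u k.
  by move=> im umi; apply: (kmax m); rewrite im.
exists (swap i k u); last first.
  move=> m; rewrite -{1}(swapK i k u) code_swap_cov // !swapE ?tpermL ?tpermR //.
  move=> m' im'; rewrite !swapE; have [->|m'k] := eqVneq m' k; first by rewrite tpermR; lia.
  rewrite tpermD 1?eq_sym // -?val_eqE /=; last by lia.
  by have := kmax m'; lia.
have [<-//|jk] := eqVneq j k.
have jk' : j < k by move: jk; rewrite -val_eqE /=; lia.
(* v lies below both words: exchanging j with k gives the move at i, exchanging
   i with j gives u'. *)
pose v := swap j k (swap i j u).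
have vi : v i = u j.
  by rewrite !swapE [tperm j k i]tpermD ?tpermL // -val_eqE /=; lia.
have vj : v j = u k.
  by rewrite !swapE tpermL tpermD // -val_eqE /=; lia.
have vk : v k = u i by rewrite !swapE tpermR tpermR.
have vm m : m != i -> m != j -> m != k -> v m = u m.
  by move=> mi mj mk; rewrite !swapE [tperm j k m]tpermD ?tpermD // eq_sym.
have ujk : u j < u k.
  have := kmax j; have := @perm_val_inj n u j k; lia.
have covk q : j < q -> cov v j q = (q == k).
  move=> jq; apply/covP/eqP=> [[_ uq none]|->]; last first.
    split=> // [|m jm mk]; rewrite ?vj ?vk //.
    have mi : m != i by rewrite -val_eqE /=; lia.
    have mj : m != j by rewrite -val_eqE /=; lia.
    have mk' : m != k by rewrite -val_eqE /=; lia.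
    rewrite vm //; have := kmax m; lia.
  apply: contrapT => /eqP qk.
  have qi : q != i by rewrite -val_eqE /=; lia.
  have qj : q != j by rewrite -val_eqE /=; lia.
  rewrite vj (vm q) // in uq none.
  have uiq : u i < u q.
    by have := kmax q; have := @perm_val_inj n u i q; move: qi; rewrite -val_eqE /=; lia.
  (* before k, the letter u q would complete a 132 with u j and u k; after k,
     the letter u i at k blocks the exchange *)
  have [qk'|kq] := ltnP q k.
    by apply: (avoid j q k) => //; lia.
  apply: (none k) => //; rewrite ?vk //.
  by move: qk; rewrite -val_eqE /=; lia.
have covi q : q < j -> cov v q j = (q == i).
  move=> qj; apply/covP/eqP=> [[_ uq none]|->]; last first.
    split=> [||m im mj]; rewrite ?vi ?vj //; lia.
  apply: contrapT => /eqP qi.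
  have qj' : q != j by rewrite -val_eqE /=; lia.
  have qk : q != k by rewrite -val_eqE /=; lia.
  have qi' : q < i by move: qi; rewrite -val_eqE /=; lia.
  rewrite vj (vm q) // in uq none.
  have uqj : u j < u q.
    have := @perm_val_inj n u j q; have := none i; rewrite vi.
    by move: qj'; rewrite -val_eqE /=; lia.
  (* the letter u j at i blocks the exchange with a smaller letter; a larger one
     is not in the padding, and forms a 132 with u i and u k *)
  have [qd|dq] := ltnP q d; first by have := code0_min (pad q qd) qj; lia.
  by apply: (avoid q i k).
have := @transition n l v j lj jl.
rewrite (bigD1 k) ?covk // big1 ?addn0 => [|q /andP[c]]; last first.
  by rewrite -covk ?c //; case/covP: c.
rewrite (bigD1 i) ?covi //= ?big1 ?addn0 => [|q /andP[c]|]; last 2 first.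
- by rewrite -covi ?c //; case/covP: c.
- by lia.
rewrite swapK => ->; rewrite [swap j i _]swapC swap_conj swapK tpermR tpermD //.
by rewrite -val_eqE /=; lia.
Qed.

(** The square x of the board is the position d + x of the word; with F chosen
accordingly, this serves both for the recursion on partitions and for the
enumeration of the ways to play. *)
Lemma cnt_step l u d B (P : pred nat) (F : nat -> nat) :
    (forall i j, adj i j -> u j < u i ->
      [/\ d <= i, i - d < B, P (i - d) & cnt l (swap i j u) = F (i - d)]) ->
    (forall x, x < B -> P x ->
      exists i, exists j, [/\ i = d + x :> nat, adj i j & u j < u i]) ->
  cnt l.+1 u = \sum_(x < B | P x) F x.
Proof.
move=> fwd bwd.
have -> : cnt l.+1 u = \sum_i \sum_(j | adj i j && (u j < u i))
    \sum_(x < B | P x && (i == d + x :> nat)) F x.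
  apply: eq_bigr => i _; apply: eq_bigr => j /andP[ij uji].
  have [di iB Pi cF] := fwd i j ij uji; rewrite [LHS]cF.
  rewrite (big_pred1 (Ordinal iB)) //= => x; rewrite /= -val_eqE /=.
  have -> : (x == i - d :> nat) = (i == d + x :> nat) by lia.
  by case: eqP => [e|]; rewrite ?andbF // andbT; have -> : x = i - d :> nat by lia.
have -> : \sum_i \sum_(j | adj i j && (u j < u i))
      \sum_(x < B | P x && (i == d + x :> nat)) F x =
    \sum_i \sum_(x < B | P x)
      \sum_(j | (adj i j && (u j < u i)) && (i == d + x :> nat)) F x.
  apply: eq_bigr => i _.
  rewrite (exchange_big_dep (fun x : 'I_B => P x)) /=; last by move=> j x _ /andP[].
  by apply: eq_bigr => x Px; apply: eq_bigl => j; rewrite Px.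
rewrite exchange_big /=; apply: eq_bigr => x Px.
have [i [j [ix ij uji]]] := bwd x (ltn_ord x) Px.
rewrite (bigD1 i) //= (big_pred1 j) => [|j']; last first.
  rewrite ix eqxx andbT; apply/andP/eqP => [[/eqP e _]|->//].
  by apply/val_inj; move/eqP: ij => /=; lia.
rewrite big1 ?addn0 // => i' ni; rewrite big_pred0 // => j'.
by apply/negbTE/negP=> /andP[_ /eqP e]; move: ni; rewrite -val_eqE /= e ix eqxx.
Qed.

End Words.

(** * Determinants of falling factorials *)

Section Determinant.
Local Open Scope ring_scope.
Variable k : nat.
Implicit Type b : nat -> nat.

Definition ffdet b : rat := \det (\matrix_(i < k, j < k) (b i ^_ j)%:R).

Lemma natr_ffact_pred (m c : nat) :
  (m * m.-1 ^_ c)%:R = (m%:R - c%:R) * (m ^_ c)%:R :> rat.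
Proof.
rewrite -ffactnS ffactnSr natrM mulrC.
have [cm|mc] := leqP c m; first by rewrite natrB.
by rewrite ffact_small // !mulr0.
Qed.

(** In the Leibniz expansion, lowering b x by 1 and multiplying by b x turns the
factor b x ^_ c into (b x - c) * b x ^_ c.  Summed over x, the factors
b x - s x add up to a number that does not depend on the permutation s. *)
Lemma ffdet_lower b :
  \sum_(x < k) (b x)%:R * ffdet (fun m => b m - (m == x))%N =
  (\sum_(x < k) (b x)%:R - \sum_(x < k) x%:R) * ffdet b.
Proof.
rewrite /ffdet /determinant mulr_sumr.
under eq_bigr do rewrite mulr_sumr.
rewrite exchange_big; apply: eq_bigr => s _ /=.
rewrite mulrCA.
under eq_bigr do rewrite mulrCA.
rewrite -mulr_sumr; congr (_ * _).
rewrite [X in _ - X](reindex_inj (@perm_inj _ s)) /= -sumrB mulr_suml.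
apply: eq_bigr => x _; rewrite (bigD1 x) //= [in RHS](bigD1 x) //= !mulrA !mxE.
rewrite eqxx subn1 -natrM natr_ffact_pred; congr (_ * _).
by apply: eq_bigr => i /negPf ix; rewrite !mxE val_eqE ix subn0.
Qed.

Lemma ffdet_eq0 b (i j : 'I_k) : i != j -> b i = b j -> ffdet b = 0.
Proof.
by move=> ij bij; apply: (determinant_alternate ij) => m; rewrite !mxE bij.
Qed.

Lemma ffdet_id : ffdet id = (\prod_(i < k) i`!)%:R.
Proof.
rewrite /ffdet det_trig.
  by rewrite natr_prod; apply: eq_bigr => i _; rewrite mxE ffactnn.
by apply/is_trig_mxP => i j ij; rewrite mxE ffact_small.
Qed.

Definition ffpoly c : {poly rat} := \prod_(t < c) ('X - t%:R%:P).

Lemma horner_ffpoly c m : (ffpoly c).[m%:R] = (m ^_ c)%:R.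
Proof.
elim: c => [|c IH]; first by rewrite /ffpoly big_ord0 hornerC.
rewrite /ffpoly big_ord_recr /= hornerM [X in X * _]IH !hornerE ffactnSr natrM.
have [cm|mc] := leqP c m; first by rewrite natrB.
by rewrite ffact_small // !mul0r.
Qed.

Lemma size_ffpoly c : size (ffpoly c) = c.+1.
Proof. by rewrite /ffpoly size_prod_XsubC /index_enum -enumT size_enum_ord. Qed.

Lemma monic_ffpoly c : ffpoly c \is monic.
Proof. by rewrite /ffpoly monic_prod_XsubC. Qed.

(** Falling factorials are monic polynomials of increasing degrees, so they are
obtained from the powers by a unitriangular change of basis. *)
Lemma ffdet_prod b :
  ffdet b = \prod_(i < k) \prod_(j < k | (i < j)%N) ((b j)%:R - (b i)%:R).
Proof.
pose a : 'rV[rat]_k := \row_i (b i)%:R.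
pose T : 'M[rat]_k := \matrix_(j, e) (ffpoly j)`_e.
have -> : ffdet b = \det (T *m Vandermonde k a)^T.
  rewrite /ffdet; congr (\det _); apply/matrixP => i j; rewrite !mxE.
  rewrite -horner_ffpoly (horner_coef_wide _ (n := k)) ?size_ffpoly //.
  by apply: eq_bigr => e _; rewrite !mxE.
rewrite det_tr det_mulmx det_Vandermonde det_trig.
  rewrite big1 ?mul1r => [|i _]; last first.
    by rewrite mxE; have /monicP := monic_ffpoly i; rewrite lead_coefE size_ffpoly.
  by apply: eq_bigr => i _; apply: eq_bigr => j _; rewrite !mxE.
apply/is_trig_mxP => i j ij; rewrite mxE nth_default // size_ffpoly //.
Qed.
End Determinant.

(** * The recursion on partitions *)

Lemma eq_ffdet k (b b' : nat -> nat) : (forall i : 'I_k, b i = b' i) -> ffdet k b = ffdet k b'.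
Proof. by move=> bb'; congr (\det _)%R; apply/matrixP => i j; rewrite !mxE bb'. Qed.

Section Dominant.
Variables (n d k : nat).
Implicit Types (u : {perm 'I_n}) (lam : nat -> nat).

(** The first d positions of the word are empty squares added to the left of the
board. *)
Definition padded_code lam u :=
  forall m : 'I_n, code u m = if m < d then 0 else lam (m - d).

Lemma padded_codeE lam u (m : 'I_n) x :
  padded_code lam u -> m = d + x :> nat -> code u m = lam x.
Proof. by move=> sh mx; rewrite sh mx ltnNge leq_addr /= addKn. Qed.

(** Rows are listed from the last to the first, which makes b strictly
increasing and equal to the identity for the empty partition, where [ffdet_id]
applies.  The sum over the corners extends to all rows: at a row that is not a
corner, lowering it makes two values of b equal, or b itself is 0 there. *)
Lemma cnt_dominant s lam u (b := fun i => lam (k - i.+1) + i) :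
    (forall x y, x <= y -> lam y <= lam x) -> (forall x, k <= x -> lam x = 0) ->
    \sum_(x < k) lam x = s -> s <= d -> d + k + s < n -> padded_code lam u ->
  ((cnt s u)%:R * (\prod_(i < k) (b i)`!)%:R = s`!%:R * ffdet k b :> rat)%R.
Proof.
rewrite {}/b; elim: s lam u => [|s IH] lam u dec lam0 sum_lam sd kn sh;
  set b := (fun i => lam (k - i.+1) + i).
  have lamz x : lam x = 0.
    have [kx|xk] := leqP k x; first exact: lam0.
    by move/eqP: sum_lam; rewrite sum_nat_eq0 => /forallP/(_ (Ordinal xk))/eqP.
  have -> : cnt 0 u = 1.
    by rewrite /=; apply/eqP; rewrite eqb1; apply/forallP => m; rewrite sh lamz if_same.
  rewrite (@eq_ffdet _ b id) => [|i]; last by rewrite /b lamz.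
  rewrite ffdet_id !mul1r; congr (_%:R)%R.
  by apply: eq_bigr => i _; rewrite /b lamz.
have n0 : 0 < n by lia.
pose pos x : 'I_n := insubd (Ordinal n0) (d + x).
have posE x : x <= k -> pos x = d + x :> nat.
  by move=> xk; rewrite val_insubd; case: ltnP => //; lia.
have adj_pos x : x < k -> adj (pos x) (pos x.+1).
  by move=> xk; rewrite /adj !posE //; lia.
have desc_pos x : x < k -> (u (pos x.+1) < u (pos x)) = (lam x.+1 < lam x).
  move=> xk; rewrite -code_adj_desc ?adj_pos // !sh !posE //; last exact: ltnW.
  by rewrite !ltnNge !leq_addr /= !addKn.
pose N x := cnt s (swap (pos x) (pos x.+1) u).
have cntE : cnt s.+1 u = \sum_(x < k | lam x.+1 < lam x) N x.
  apply: (@cnt_step _ _ _ d k (fun x => lam x.+1 < lam x)) => [i j ij uji|x xk Px].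
    have := code_adj_desc u ij; rewrite uji !sh (eqP ij) => /esym.
    case: (ltnP i d) => [|di]; first by rewrite ltn0.
    have -> : (i.+1 < d) = false by lia.
    rewrite subSn // => ldesc.
    have ik : i - d < k.
      by rewrite ltnNge; apply/negP => /lam0 e; move: ldesc; rewrite e.
    have -> : i = pos (i - d) by apply/val_inj; rewrite /= posE; lia.
    have -> : j = pos (i - d).+1 by apply/val_inj; rewrite /= posE ?(eqP ij); lia.
    split; rewrite ?posE ?leq_addr ?addKn //; lia.
  exists (pos x), (pos x.+1); rewrite posE ?desc_pos ?adj_pos //; exact: ltnW.
have NE (x : 'I_k) :
    ((lam x.+1 < lam x)%:R * (N x)%:R * (\prod_(i < k) (b i)`!)%:R =
     s`!%:R * ((b (rev_ord x))%:R * ffdet k (fun m => b m - (m == rev_ord x))%N) :> rat)%R.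
  have [Px|nPx] := boolP (lam x.+1 < lam x); last first.
    (* not a corner: two equal rows, or the last row and it is empty *)
    rewrite mul0r mul0r; have lamx : lam x.+1 = lam x by have := dec x x.+1; lia.
    have [xk|kx] := ltnP x.+1 k; last first.
      rewrite /b /=; have -> : k - (k - x.+1).+1 = x by have := ltn_ord x; lia.
      by rewrite -lamx lam0 // (eqP (_ : k - x.+1 == 0)) ?mul0r ?mulr0.
    rewrite (@ffdet_eq0 k _ (rev_ord x) (rev_ord (Ordinal xk))) ?mulr0 //.
      by rewrite -val_eqE /=; lia.
    rewrite /b /= eqxx; have -> : k - (k - x.+1).+1 = x by lia.
    have -> : k - (k - x.+2).+1 = x.+1 by lia.
    by rewrite lamx; case: eqP; lia.
  have xk := ltn_ord x.
  pose i := pos x; pose j := pos x.+1.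
  have [|||||||u' Nu' codeu'] := @dominant_move n s d u i j.
  - by move=> m md; rewrite sh md.
  - move=> m m' dm mm'; rewrite !sh [m < d]ltnNge dm [m' < d]ltnNge (leq_trans dm mm').
    by apply: dec; lia.
  - by rewrite posE //; lia.
  - exact: adj_pos.
  - by rewrite desc_pos.
  - by rewrite posE //; lia.
  - by rewrite posE //; lia.
  have lamx : 0 < lam x by apply: leq_trans Px.
  pose b' y := (lam (k - y.+1) - (k - y.+1 == x)) + y.
  have Nb' : ((cnt s u')%:R * (\prod_(i < k) (b' i)`!)%:R =
      s`!%:R * ffdet k b' :> rat)%R.
    apply: (IH (fun y => lam y - (y == x))).
    - move=> y z; case: (eqVneq y x) => [->|_] yz; have := dec _ _ yz; last by lia.
      case: (eqVneq z x) => [_|zx]; first by lia.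
      by have := dec x.+1 z; lia.
    - by move=> y ky; rewrite lam0.
    - move: sum_lam; rewrite (bigD1 x) //= => sum_lam; rewrite (bigD1 x) //= eqxx.
      rewrite (eq_bigr (fun i : 'I_k => lam i)) => [|y]; first by lia.
      by rewrite -val_eqE /= => /negPf->; rewrite subn0.
    - by lia.
    - by lia.
    - move=> m; have := codeu' m; rewrite sh -val_eqE /= /i posE; last by lia.
      by case: ltnP => md; last (have -> : (m == d + x :> nat) = (m - d == x) by lia); lia.
  have b'E (y : 'I_k) : b' y = b y - (y == rev_ord x :> nat).
    rewrite /b' /b /=; have yk := ltn_ord y.
    have -> : (k - y.+1 == x) = (y == k - x.+1 :> nat) by lia.
    case: eqP => [->|]; last by lia.
    have -> : k - (k - x.+1).+1 = x by lia.
    by lia.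
  have brx : b (rev_ord x) = lam x + (k - x.+1).
    by rewrite /b /=; congr (lam _ + _); lia.
  rewrite /N Nu' mul1r (eq_ffdet (b' := b')) => [|y]; last exact/esym/b'E.
  rewrite [RHS]mulrCA -Nb' mulrCA; congr (_ * _)%R.
  rewrite (bigD1 (rev_ord x)) // [in RHS](bigD1 (rev_ord x)) // -!natrM b'E eqxx subn1.
  rewrite mulnA; congr (_ * _)%:R%R.
    by rewrite brx; case: (lam x) lamx => // y _; rewrite addSn factS.
  by apply: eq_bigr => y /negPf yx; rewrite b'E val_eqE yx subn0.
rewrite cntE natr_sum big_mkcond mulr_suml.
transitivity (\sum_(x < k)
    (lam x.+1 < lam x)%:R * (N x)%:R * (\prod_(i < k) (b i)`!)%:R : rat)%R.
  by apply: eq_bigr => x _; case: (_ < _); rewrite ?mul1r ?mul0r.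
rewrite (eq_bigr _ (fun x _ => NE x)) -mulr_sumr.
rewrite -(reindex_inj rev_ord_inj (P := xpredT)
  (F := fun x : 'I_k => ((b x)%:R * ffdet k (fun m => b m - (m == x))%N)%R)).
rewrite ffdet_lower mulrA; congr (_ * _)%R.
rewrite factS mulnC natrM; congr (_ * _)%R.
rewrite -sumrB -sum_lam natr_sum (reindex_inj rev_ord_inj); apply: eq_bigr => i _.
rewrite /b natrD addrK; congr (lam _)%:R%R; rewrite /=; have := ltn_ord i; lia.
Qed.
End Dominant.

(** * From the game to permutations *)

(** B bounds the squares where a move is tried; for a position encoded by a word
of length n, every legal move is below n. *)
Fixpoint ways B l (p : position) : seq (seq nat) :=
  if l is l'.+1 then
    [seq x :: w | x <- [seq x <- iota 0 B | legal p x], w <- ways B l' (make_move p x)]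
  else if is_empty p then [:: [::]] else [::].

Lemma ways_uniq B l p : uniq (ways B l p).
Proof.
elim: l p => [|l IH] p /=; first by case: is_empty.
apply: allpairs_uniq_dep => [|x _|]; [|exact: IH|].
  by rewrite filter_uniq ?iota_uniq.
by move=> [x w] [y v] _ _ /= [-> ->].
Qed.

Lemma candies_move p x y : candies (make_move p x) y =
  if y == x then candies p x.+1 else if y == x.+1 then (candies p x).-1
  else candies p y.
Proof.
rewrite /candies /make_move !nth_set_nth /= nth_set_nth /=.
by case: eqP => [->|]; case: eqP => //; lia.
Qed.

Section Game.
Variables (n d : nat).
Implicit Types (u : {perm 'I_n}) (i j m : 'I_n) (p : position).

(** The board is the word from position d on.  The d padding squares never take
part in a play, since an empty pile cannot be moved to the right. *)
Definition encodes u p :=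
  padded_code d (candies p) u /\ forall x, n <= d + x -> candies p x = 0.

Lemma encodes_desc u p i j : encodes u p -> adj i j -> u j < u i ->
  d <= i /\ legal p (i - d).
Proof.
move=> [sh _] ij; rewrite -code_adj_desc // !sh (eqP ij).
case: (ltnP i d) => [|di]; first by rewrite ltn0.
have -> : (i.+1 < d) = false by lia.
by rewrite subSn.
Qed.

Lemma encodes_legal u p x : encodes u p -> legal p x ->
  exists i, exists j, [/\ i = d + x :> nat, adj i j & u j < u i].
Proof.
move=> [sh far] leg.
have xn : d + x < n.
  by rewrite ltnNge; apply/negP => /far e; move: leg; rewrite /legal e.
have xn1 : d + x.+1 < n.
  have := code_bound u (Ordinal xn); rewrite (padded_codeE (x := x) sh) //=.
  by move: leg; rewrite /legal; lia.
exists (Ordinal xn), (Ordinal xn1); have a : adj (Ordinal xn) (Ordinal xn1).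
  by rewrite /adj /= addnS.
split=> //; rewrite -code_adj_desc //.
by rewrite (padded_codeE (x := x.+1) sh) // (padded_codeE (x := x) sh).
Qed.

Lemma encodes_move u p i j : encodes u p -> adj i j -> u j < u i ->
  encodes (swap i j u) (make_move p (i - d)).
Proof.
move=> enc ij uji; have [di leg] := encodes_desc enc ij uji.
case: enc => sh far; have /eqP ijn := ij; split=> [m|x nx]; last first.
  by rewrite candies_move; do 2 (case: eqP => ?; first by have := ltn_ord j; lia); apply: far.
rewrite code_adj // !sh candies_move -!val_eqE /= ijn.
have -> : (i < d) = false by lia.
have -> : (i.+1 < d) = false by lia.
case: (ltnP m d) => [md|dm].
  by do 2 (case: eqP => ?; first by lia).
have -> : (m - d == i - d) = (m == i :> nat) by lia.
have -> : (m - d == (i - d).+1) = (m == i.+1 :> nat) by lia.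
by rewrite subSn.
Qed.

Lemma encodes_empty u p : encodes u p -> is_empty p = [forall m, code u m == 0].
Proof.
move=> [sh far]; apply/allP/forallP => [p0 m|c0 x].
  rewrite sh; case: ifP => // _; rewrite /candies.
  have [mp|pm] := ltnP (m - d) (size p); last by rewrite nth_default.
  by have := p0 _ (mem_nth 0 mp).
move/(nthP 0) => [y yp <-] /=; have [ny|yn] := leqP n (d + y); first by apply/eqP/far.
by have := c0 (Ordinal yn); rewrite (padded_codeE (x := y) sh).
Qed.

Lemma size_ways l u p : encodes u p -> size (ways n l p) = cnt l u.
Proof.
elim: l u p => [|l IH] u p enc.
  by rewrite /= -(encodes_empty enc); case: is_empty.
rewrite size_allpairs_dep sumnE big_map big_filter.
have -> : iota 0 n = index_iota 0 n by rewrite /index_iota subn0.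
rewrite big_mkord; apply/esym.
apply: (@cnt_step _ _ _ d n (legal p) (fun x => size (ways n l (make_move p x)))).
  move=> i j ij uji; have [di leg] := encodes_desc enc ij uji.
  split=> //; first by have := ltn_ord i; lia.
  by rewrite (IH _ _ (encodes_move enc ij uji)).
by move=> x _; exact: encodes_legal.
Qed.

Lemma mem_ways l u p w : encodes u p ->
  (w \in ways n l p) = (size w == l) && is_way p w.
Proof.
elim: l u p w => [|l IH] u p w enc.
  by case: w => [|x w] /=; case: is_empty; rewrite ?inE.
apply/allpairsPdep/idP=> [[x [v [+ wv ->]]]|].
  rewrite mem_filter => /andP[leg _]; have [i [j [ix ij uji]]] := encodes_legal enc leg.
  have := encodes_move enc ij uji; rewrite ix addKn => enc'.
  by move: wv; rewrite (IH _ _ _ enc') /= leg.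
case: w => [//|x w] /= /andP[sw /andP[leg ww]].
have [i [j [ix ij uji]]] := encodes_legal enc leg.
have := encodes_move enc ij uji; rewrite ix addKn => enc'.
exists x, w; rewrite (IH _ _ _ enc') mem_filter leg mem_iota /= ww andbT.
by split=> //; have := ltn_ord i; lia.
Qed.

Lemma size_way u p w : encodes u p -> is_way p w -> size w = \sum_m code u m.
Proof.
elim: w u p => [|x w IH] u p enc /=.
  rewrite (encodes_empty enc) => /forallP c0.
  by rewrite big1 // => m _; apply/eqP.
move=> /andP[leg ww]; have [i [j [ix ij uji]]] := encodes_legal enc leg.
have := encodes_move enc ij uji; rewrite ix addKn => enc'.
rewrite (IH _ _ enc' ww).
have ji : j != i by move/eqP: ij; rewrite -val_eqE /=; lia.
have cij : code u j < code u i by rewrite code_adj_desc.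
rewrite (bigD1 i) //= (bigD1 j) //= [RHS](bigD1 i) //= [in RHS](bigD1 j) //=.
rewrite !code_adj // !eqxx (negPf ji).
under eq_bigr => m /andP[/negPf mi /negPf mj] do rewrite code_adj // mi mj.
by lia.
Qed.

End Game.


Local Open Scope classical_set_scope.
Local Open Scope card_scope.
Local Open Scope ring_scope.

Theorem theorem1 (k : nat) (a : k.-tuple nat)
    (k_ge1 : (1 <= k)%N)
    (a_noninc : forall i j : 'I_k, (i <= j)%N -> (tnth a j <= tnth a i)%N)
    (a_gt0 : forall i : 'I_k, (0 < tnth a i)%N) :
  exists n : nat,
    [set w : seq nat | is_way a w] #= `I_n /\
    n%:R = ((\sum_(i < k) tnth a i)%N)`!%:R
             / (\prod_(i < k) (tnth a i + (k - i.+1))`!)%N%:R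
           * \prod_(i < k) \prod_(j < k | (i < j)%N)
               ((tnth a i)%:R - (tnth a j)%:R + j%:R - i%:R) :> rat.
Proof.
set s := (\sum_(i < k) tnth a i)%N.
pose lam := candies a.
have lamE (i : 'I_k) : lam i = tnth a i by rewrite (tnth_nth 0%N).
have lam_far x : (k <= x)%N -> lam x = 0%N.
  by move=> kx; rewrite /lam /candies nth_default ?size_tuple.
have lam_dec x y : (x <= y)%N -> (lam y <= lam x)%N.
  move=> xy; have [ky|yk] := leqP k y; first by rewrite lam_far.
  have := a_noninc (Ordinal (leq_ltn_trans xy yk)) (Ordinal yk) xy.
  by rewrite -!lamE.
have sum_lam : (\sum_(x < k) lam x = s)%N by apply: eq_bigr => i _; rewrite lamE.
clearbody s.
have lam_le x : (lam x <= s)%N.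
  have [kx|xk] := leqP k x; first by rewrite lam_far.
  by rewrite -sum_lam (bigD1 (Ordinal xk)) //= leq_addr.
(* s empty squares to the left of the board and s + 1 to its right: a play has s
   moves, so the letter followed by the transition equation stays inside. *)
have [n nE] : exists n, n = (s + k + s).+1 by exists (s + k + s).+1.
have [u codeu] : exists u : {perm 'I_n}, padded_code s lam u.
  apply: (@code_surj n (fun m => if (m < s)%N then 0%N else lam (m - s)%N)) => m /=.
  case: (ltnP m s) => [_|sm]; first by rewrite addn0 ltn_ord.
  have [km|mk] := leqP k (m - s)%N; first by rewrite lam_far ?addn0.
  by have := lam_le (m - s)%N; move: (lam _) => y; lia.
have enc : encodes s u a.
  by split=> // x nx; apply: lam_far; move: nx; lia.
have sum_code : (\sum_m code u m = s)%N.
  rewrite (eq_bigr _ (fun m _ => codeu m)).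
  rewrite -(big_mkord xpredT (fun m => if m < s then 0 else lam (m - s))%N).
  rewrite (big_cat_nat (n := s)) //=; last by lia.
  rewrite big_nat_cond big1 ?add0n => [|m /andP[/andP[_ ->]]] //.
  rewrite -{1}[s]add0n big_addn (big_cat_nat (n := k)) //=; last by lia.
  rewrite [X in (_ + X)%N]big_nat_cond [X in (_ + X)%N]big1 ?addn0; last first.
    by move=> m /andP[/andP[km _] _]; rewrite addnK lam_far ?if_same.
  by rewrite big_mkord -sum_lam; apply: eq_bigr => x _; rewrite addnK ltnNge leq_addl.
exists (cnt s u); split.
  have -> : [set w | is_way a w] = [set` [fset w in ways n s a]%fset].
    apply/seteqP; split=> w /=; rewrite !inE /= (mem_ways _ _ enc).
      by move=> ww; rewrite (size_way enc ww) sum_code eqxx.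
    by case/andP.
  apply/card_eq_fsetP; rewrite card_fseq undup_id ?ways_uniq //.
  exact: (size_ways s enc).
pose b y := (lam (k - y.+1) + y)%N.
have cntE : (cnt s u)%:R * (\prod_(i < k) (b i)`!)%N%:R = s`!%:R * ffdet k b :> rat.
  by apply: (@cnt_dominant n s k s lam u) => //; lia.
set D := (\prod_(i < k) _)%N.
set V := \prod_(i < k) _.
have bE (i : 'I_k) : b (rev_ord i) = (tnth a i + (k - i.+1))%N.
  by rewrite -lamE /b /=; congr (lam _ + _)%N; have := ltn_ord i; lia.
have DE : (\prod_(i < k) (b i)`!)%N = D.
  by rewrite (reindex_inj rev_ord_inj); apply: eq_bigr => i _; rewrite bE.
have VE : ffdet k b = V.
  rewrite ffdet_prod (reindex_inj rev_ord_inj).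
  under eq_bigr do rewrite (reindex_inj rev_ord_inj).
  rewrite (exchange_big_dep xpredT) //=; apply: eq_bigr => i _.
  apply: eq_big => [j|j ij]; first by have := ltn_ord i; have := ltn_ord j; lia.
  rewrite !bE !natrD !natrB ?ltn_ord // -!natr1; ring.
have D0 : D%:R != 0 :> rat.
  by rewrite Num.Theory.pnatr_eq0 -lt0n prodn_gt0 // => i; apply: fact_gt0.
by rewrite mulrAC -VE -cntE DE mulfK.
Qed.
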